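(* Let $m\ge3$. Let $(b_n)_{n\ge1}$, $(c_n)_{n\ge0}$ be real sequences with $c_n\neq0$ and $b_n\neq0$ for all $n$, and let $(A_n)_{n\ge0}$, $(B_n)_{n\ge0}$ be two linearly independent rational-valued solutions of $$c_ny_{n+1}+c_{n-1}y_{n-1}-b_ny_n=0,\qquad n\ge1,$$ with $A_n>0$, $B_n>0$ for all $n$, such that $\lim_{n\to\infty}B_n/A_n=L$ with $L\neq0$. Assume the Casoratian $W_n$ defined in the context is nonzero for all $n\ge1$. Then $L$ is algebraic of degree at most $m$ over $\mathbb{Q}$ if and only if the $(m+2)$-term linear recurrence relation $\mathcal{R}_m$ (defined in the context) has a non-trivial rational-valued solution $(S_n)$ such that $$\frac{S_n}{A_{n+m-2}\cdots A_{n+1}A_nA_{n-1}}\to0\quad(n\to\infty).$$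
   Context: For $n\ge1$ let $I_n=\{n-1,n,\dots,n+m-2\}$ (a set of $m$ indices), and for $k\in\{0,1,\dots,m\}$ define $$x_{k+1}^{(n-1)}=\sum_{T\subseteq I_n,\ |T|=k}\ \prod_{j\in T}B_j\prod_{j\in I_n\setminus T}A_j,$$ a sum of $\binom{m}{k}$ terms (so $x_1^{(n-1)}=A_{n+m-2}\cdots A_{n-1}$ and $x_{m+1}^{(n-1)}=B_{n+m-2}\cdots B_{n-1}$). Let $W_n=\det\big[x_j^{(n-1+i)}\big]_{0\le i\le m,\,1\le j\le m+1}$. The $(m+2)$-term linear recurrence relation $\mathcal{R}_m$ is the relation on real sequences $(z_j)_{j\ge0}$ given, for every $n\ge1$, by the vanishing of the determinant of the $(m+2)\times(m+2)$ matrix whose row $i$ ($i=0,1,\dots,m+1$) is $\big(z_{n-1+i},\,x_1^{(n-1+i)},\,x_2^{(n-1+i)},\dots,x_{m+1}^{(n-1+i)}\big)$.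
   Formalization: The solution is indexed from n=1 with S_n = z_{n-1}, so that S_n stands in the same matrix row as x_j^{(n-1)}; with S_n = z_n the claim fails, e.g. for A_n = 2^{-n^2}, B_n/A_n strictly increasing to a transcendental L, and z_n = A_n...A_{n+m-1}. *)

(* Defs.v *)
From HB Require Import structures.
From mathcomp Require Import all_boot all_order all_algebra.
From mathcomp Require Import all_classical all_reals all_analysis.
Set Implicit Arguments.
Unset Strict Implicit.
Unset Printing Implicit Defensive.
Import Order.TTheory GRing.Theory Num.Theory.
Import numFieldNormedType.Exports.
Local Open Scope classical_set_scope.
Local Open Scope ring_scope.

Definition rational_valued (R : realType) (u : R^nat) : Prop :=
  forall n, rational (u n).

Definition solves_three_term (R : realType) (b c y : R^nat) : Prop :=
  forall n, (1 <= n)%N -> c n * y n.+1 + c n.-1 * y n.-1 - b n * y n = 0.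

Definition linearly_independent2 (R : realType) (u v : R^nat) : Prop :=
  forall s t : R, (forall n, s * u n + t * v n = 0) -> s = 0 /\ t = 0.

Definition algebraic_of_degree (R : realType) (x : R) (d : nat) : Prop :=
  (exists p : {poly rat}, size p = d.+1 /\ root (map_poly ratr p) x) /\
  (forall q : {poly rat}, q != 0 -> root (map_poly ratr q) x -> (d < size q)%N).

Definition algebraic_of_degree_le (R : realType) (x : R) (m : nat) : Prop :=
  exists d, (d <= m)%N /\ algebraic_of_degree x d.

(* [sym_prod m A B k N] is x_{k+1}^{(N)}: the index set {N, ..., N+m-1} is
   represented by 'I_m via i |-> N + i. *)
Definition sym_prod (R : realType) (m : nat) (A B : R^nat) (k N : nat) : R :=
  \sum_(T : {set 'I_m} | #|T| == k)
    (\prod_(j in T) B (N + j)%N) * (\prod_(j in ~: T) A (N + j)%N).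

(* Columns are indexed from 0 here, so column k holds x_{k+1}. *)
Definition casoratian (R : realType) (m : nat) (A B : R^nat) (n : nat) : R :=
  \det (\matrix_(i < m.+1, k < m.+1) sym_prod m A B k (n.-1 + i)%N).

Definition recurrence_matrix (R : realType) (m : nat) (A B z : R^nat) (n : nat)
    : 'M[R]_m.+2 :=
  row_mx (\col_(i < m.+2) z (n.-1 + i)%N)
         (\matrix_(i < m.+2, k < m.+1) sym_prod m A B k (n.-1 + i)%N).

(* The term of the sequence that is matched with x_j^{(n-1)}, and hence with
   the product A_{n+m-2} ... A_{n-1} = x_1^{(n-1)}, is z_{n-1}. *)
Definition solves_Rm (R : realType) (m : nat) (A B z : R^nat) : Prop :=
  forall n, (1 <= n)%N -> \det (recurrence_matrix m A B z n) = 0.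

(* Main.v *)
(* If z solves R_m, each determinant gives a linear relation between the
   columns of a window of m + 2 consecutive rows; as W_n <> 0, it expresses z
   there as a combination of the x_{k+1}, and since consecutive windows share
   m + 1 rows, W_n <> 0 also makes the coefficients independent of the window.
   Cramer's rule makes them rational when z is.  Dividing
   z_N = \sum_k e_k x_{k+1}^{(N)} by the product of the A_{N+j} and letting N
   tend to infinity gives \sum_k e_k 'C(m, k) L^k, so rational solutions that are
   negligible before the product correspond to rational polynomials of degree
   at most m that vanish at L. *)
Require Import Defs.
From HB Require Import structures.
From mathcomp Require Import all_boot all_order all_algebra.
From mathcomp Require Import all_classical all_reals all_analysis.
Import Order.TTheory GRing.Theory Num.Theory.
Import numFieldNormedType.Exports.
Local Open Scope classical_set_scope.
Local Open Scope ring_scope.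

(** The least size among nonzero rational polynomials vanishing at [x] fixes the exact degree, so
    bounding the degree only takes one such polynomial that is small enough. *)
Lemma algebraic_of_degree_leP {R : realType} (x : R) (m : nat) :
  algebraic_of_degree_le x m <->
  exists p : {poly rat},
    [/\ p != 0, (size p <= m.+1)%N & root (map_poly ratr p) x].
Proof.
split=> [[d [ledm [[p [szp px]] _]]]|[p [p0 szp px]]].
  by exists p; rewrite -size_poly_gt0 szp ltnS.
pose P n := `[< exists q : {poly rat},
  [/\ q != 0, size q = n.+1 & root (map_poly ratr q) x] >].
have Pp : P (size p).-1.
  by apply/asboolP; exists p; rewrite prednK // size_poly_gt0.
have exP : exists n, P n by exists (size p).-1.
case: (ex_minnP exP) => d /asboolP[q [q0 szq qx]] mind.
exists d; split; first by rewrite (leq_trans (mind _ Pp)) // -subn1 leq_subLR.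
split; first by exists q.
move=> r r0 rx; have szr : (0 < size r)%N by rewrite size_poly_gt0.
rewrite -(prednK szr) ltnS; apply: mind; apply/asboolP.
by exists r; rewrite prednK.
Qed.

Lemma rational_mxP {R : realType} p q (M : 'M[R]_(p, q)) :
  (forall i j, rational (M i j)) -> exists N, M = map_mx ratr N.
Proof.
move=> ratM.
have /choice[f fE] (ij : 'I_p * 'I_q) : exists x : rat, ratr x = M ij.1 ij.2.
  by have [x _ <-] := ratM ij.1 ij.2; exists x.
by exists (\matrix_(i, j) f (i, j)); apply/matrixP => i j; rewrite !mxE fE.
Qed.

Lemma rational_sym_prod {R : realType} m (A B : R^nat) k N :
  rational_valued A -> rational_valued B -> rational (sym_prod m A B k N).
Proof.
have lift (u : R^nat) : rational_valued u -> exists v : rat^nat, u = ratr \o v.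
  move=> ratu; have /choice[v vE] n : exists x, ratr x = u n.
    by have [x _ <-] := ratu n; exists x.
  by exists v; apply/funext => n /=; rewrite vE.
move=> /lift[a ->] /lift[b ->].
exists (\sum_(T : {set 'I_m} | #|T| == k)
    (\prod_(j in T) b (N + j)%N) * (\prod_(j in ~: T) a (N + j)%N)) => //.
rewrite rmorph_sum; apply: eq_bigr => T _.
by rewrite rmorphM !rmorph_prod.
Qed.

Section SymProdCombinations.
Context {R : realType} (m : nat) (A B : R^nat).

Definition sym_comb (e : 'cV[R]_m.+1) (N : nat) : R :=
  \sum_(k < m.+1) sym_prod m A B k N * e k 0.

Lemma sym_combE e n (i : 'I_m.+1) :
  (\matrix_(i < m.+1, k < m.+1) sym_prod m A B k (n + i) *m e) i 0 =
  sym_comb e (n + i).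
Proof. by rewrite mxE; apply: eq_bigr => k _; rewrite mxE. Qed.

(** The Casoratian at [n.+1] is the determinant of the rows [n], ..., [n + m], so these values
    determine the coefficients by inverting that matrix. *)
Lemma sym_comb_inj n e e' : casoratian m A B n.+1 != 0 ->
  (forall i, (i <= m)%N -> sym_comb e (n + i) = sym_comb e' (n + i)) -> e = e'.
Proof.
rewrite -unitfE => Wn eqee'.
apply: (can_inj (mulKmx (Wn : _ \in unitmx))).
apply/matrixP => i j; rewrite ord1 !sym_combE.
by apply: eqee'; rewrite -ltnS.
Qed.

Lemma rational_coef_sym_comb z e :
  rational_valued A -> rational_valued B -> rational_valued z ->
  casoratian m A B 1 != 0 -> (forall n, z n = sym_comb e n) ->
  exists d, e = map_mx ratr d.
Proof.
move=> ratA ratB ratz; rewrite -unitfE => W1 zE.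
have [M ME] : exists M, \matrix_(i < m.+1, k < m.+1) sym_prod m A B k (0 + i) =
    map_mx ratr M.
  by apply: rational_mxP => i j; rewrite mxE; apply: rational_sym_prod.
have [v vE] : exists v, \col_(i < m.+1) z i = map_mx ratr v.
  by apply: rational_mxP => i j; rewrite mxE.
(* The system of the first window is solved over [rat]: matrix inversion commutes with [ratr]. *)
exists (invmx M *m v); rewrite map_mxM map_invmx -ME -vE.
apply: (canRL (mulKmx (W1 : _ \in unitmx))).
by apply/matrixP => i j; rewrite ord1 sym_combE mxE zE.
Qed.

Lemma mul_recurrence_matrix z n (w : 'cV[R]_(1 + m.+1)) i :
  (recurrence_matrix m A B z n *m w) i 0 =
  z (n.-1 + i)%N * usubmx w 0 0 + sym_comb (dsubmx w) (n.-1 + i).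
Proof.
rewrite -[w in LHS]vsubmxK [_ *m _](mul_row_col (\col_(i < m.+2) z (n.-1 + i)%N)).
rewrite mxE; congr (_ + _).
  by rewrite mxE big_ord1 !mxE.
by rewrite mxE; apply: eq_bigr => k _; rewrite mxE.
Qed.

Lemma sym_comb_solves e : solves_Rm m A B (sym_comb e).
Proof.
(* [det0P] speaks of left kernels; transposing turns it into a relation between columns, here given
   by the coefficients 1 and [- e]. *)
move=> n _; rewrite -det_tr; apply/eqP/det0P.
pose w : 'cV[R]_(1 + m.+1) := col_mx 1 (- e).
exists w^T.
  rewrite trmx_eq0; apply/eqP => /(congr1 (fun u : 'cV_(1 + _) => usubmx u 0 0)).
  by rewrite col_mxKu !mxE => /eqP; rewrite oner_eq0.
rewrite -trmx_mul; apply/matrixP => j i; rewrite ord1 mxE.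
rewrite mul_recurrence_matrix col_mxKu col_mxKd !mxE mulr1 /sym_comb.
by rewrite -big_split big1 // => k _ /=; rewrite mxE mulrN subrr.
Qed.

Lemma solves_window z n : casoratian m A B n.+1 != 0 ->
  \det (recurrence_matrix m A B z n.+1) = 0 ->
  exists e, forall i, (i <= m.+1)%N -> z (n + i)%N = sym_comb e (n + i).
Proof.
move=> Wn; rewrite -det_tr => /eqP/det0P[v v0 /(congr1 trmx)].
rewrite trmx_mul trmxK trmx0; set w : 'cV_(1 + _) := v^T => w0.
have wE i : (i <= m.+1)%N ->
    z (n + i)%N * usubmx w 0 0 + sym_comb (dsubmx w) (n + i) = 0.
  move=> lim; have := mul_recurrence_matrix z n.+1 w (Ordinal (lim : (i < m.+2)%N)).
  by rewrite w0 mxE.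
have u0 : usubmx w 0 0 != 0.
  (* Were the coefficient of the column of [z] zero, the first [m.+1] rows would relate the other
     columns alone, and invertibility would make the whole relation trivial. *)
  apply: contraNneq v0 => u0; rewrite -trmx_eq0 -[v^T]/w.
  rewrite -[w]vsubmxK [usubmx w]mx11_scalar u0 -scalemx1 scale0r.
  suff -> : dsubmx w = 0 by rewrite col_mx0.
  apply: (sym_comb_inj _ _ _ Wn) => i lim.
  have := wE i (leqW lim); rewrite u0 mulr0 add0r => ->.
  by rewrite /sym_comb big1 // => k _; rewrite mxE mulr0.
move: u0 wE; move: (usubmx w 0 0) (dsubmx w) => u x u0 {}wE.
exists (- u^-1 *: x) => i lim.
apply: (mulIf u0); apply: oppr_inj.
rewrite (addr0_eq (wE i lim)) /sym_comb mulr_suml -sumrN.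
apply: eq_bigr => k _.
by rewrite mxE mulNr mulrN mulNr opprK -mulrA mulrAC mulVf // mul1r.
Qed.

Lemma solves_RmP z :
  (forall n, (1 <= n)%N -> casoratian m A B n != 0) -> solves_Rm m A B z ->
  exists e, forall n, z n = sym_comb e n.
Proof.
move=> W zR; have [e eE] := solves_window _ 0 (W 1 isT) (zR 1 isT).
suff zE N i : (i <= m.+1)%N -> z (N + i)%N = sym_comb e (N + i).
  by exists e => N; rewrite -[N]addn0 zE.
elim: N i => // N IH.
have [e' e'E] := solves_window _ N.+1 (W N.+2 isT) (zR N.+2 isT).
suff -> : e = e' by [].
(* The rows common to both windows, [N.+1] to [N.+1 + m], are exactly those of the Casoratian at
   [N.+2]. *)
apply: (sym_comb_inj N.+1 _ _ (W N.+2 isT)) => i lim.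
by rewrite -e'E ?(leqW lim) // addSnnS IH.
Qed.

(** In each summand the factors of [A] outside [T] cancel, leaving [k] ratios that each tend to [L];
    the binomial counts the sets [T]. *)
Lemma cvg_sym_prod (L : R) k : (forall n, A n != 0) -> B n / A n @[n --> \oo] --> L ->
  sym_prod m A B k N / \prod_(j < m) A (N + j)%N @[N --> \oo] -->
  'C(m, k)%:R * L ^+ k.
Proof.
move=> A0 BAL.
have -> : (fun N => sym_prod m A B k N / \prod_(j < m) A (N + j)%N) =
    (fun N => \sum_(T : {set 'I_m} | #|T| == k)
                \prod_(j in T) (B (N + j)%N / A (N + j)%N)).
  apply/funext => N; rewrite /sym_prod mulr_suml; apply: eq_bigr => T _.
  rewrite prodf_div (bigID (mem T) predT) /=.
  rewrite [X in _ * X^-1](_ : _ =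
    (\prod_(j in T) A (N + j)%N) * (\prod_(j in ~: T) A (N + j)%N)); last first.
    by congr (_ * _); apply: eq_bigl => j; rewrite inE.
  rewrite invfM mulrACA divff ?mulr1 //.
  by apply/prodf_neq0 => j _.
have -> : 'C(m, k)%:R * L ^+ k =
    \sum_(T : {set 'I_m} | #|T| == k) \prod_(j in T) L.
  rewrite (eq_bigr (fun=> L ^+ k)) => [|T /eqP <-]; last first.
    by rewrite prodr_const.
  by rewrite sumr_const -[in 'C(m, k)](card_ord m) -card_draws mulr_natl cardsE.
apply: (cvg_big add_continuous) => T _.
apply: (cvg_big mul_continuous) => j _.
by move: BAL; rewrite -(cvg_shiftn j).
Qed.

Lemma cvg_sym_comb (L : R) e : (forall n, A n != 0) -> B n / A n @[n --> \oo] --> L ->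
  sym_comb e N / \prod_(j < m) A (N + j)%N @[N --> \oo] -->
  \sum_(k < m.+1) ('C(m, k)%:R * L ^+ k) * e k 0.
Proof.
move=> A0 BAL.
under eq_fun do rewrite /sym_comb mulr_suml.
apply: (cvg_big add_continuous) => k _.
under eq_fun do rewrite mulrAC.
exact: cvgMr_tmp (cvg_sym_prod _ _ A0 BAL).
Qed.

End SymProdCombinations.

(* S is indexed from n = 1, with S_n = z_{n-1} as an argument of the
   recurrence R_m; the value S 0 is irrelevant. *)
Theorem theorem4p4 (R : realType) (m : nat) (hm : (3 <= m)%N)
    (b c A B : R^nat) (L : R)
    (hc : forall n, c n != 0)
    (hb : forall n, (1 <= n)%N -> b n != 0)
    (hArat : rational_valued A) (hBrat : rational_valued B)
    (hA : solves_three_term b c A) (hB : solves_three_term b c B)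
    (hAB : linearly_independent2 A B)
    (hApos : forall n, 0 < A n) (hBpos : forall n, 0 < B n)
    (hlim : B n / A n @[n --> \oo] --> L)
    (hL : L != 0)
    (hW : forall n, (1 <= n)%N -> casoratian m A B n != 0) :
  algebraic_of_degree_le L m <->
  exists S : R^nat,
    [/\ rational_valued S,
        exists n, (1 <= n)%N /\ S n != 0,
        solves_Rm m A B (fun j => S j.+1) &
        S n / \prod_(n.-1 <= j < (n + m).-1) A j @[n --> \oo] --> (0 : R)].
Proof.
have A0 n : A n != 0 by rewrite gt_eqF.
(* With n = N + 1 the product runs over the window starting at [N]; the dropped term at n = 0 does
   not affect the limit. *)
have winE (S : R^nat) (l : R) :
    S n / \prod_(n.-1 <= j < (n + m).-1) A j @[n --> \oo] --> l =
    (S N.+1 / \prod_(j < m) A (N + j)%N @[N --> \oo] --> l).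
  rewrite -[LHS]cvg_shiftS; apply: (congr1 (fun f : R^nat => f @ \oo --> l)).
  apply/funext => N /=; rewrite -[in X in \prod_(X <= _ < _) _](add0n N).
  rewrite big_addn addKn big_mkord.
  by congr (_ / _); apply: eq_bigr => j _; rewrite addnC.
have C0 (F : numFieldType) (k : 'I_m.+1) : 'C(m, k)%:R != 0 :> F.
  by rewrite pnatr_eq0 -lt0n bin_gt0 -ltnS.
rewrite algebraic_of_degree_leP; split.
  move=> [p [p0 szp /rootP px]].
  (* Dividing by the binomials cancels those in the limit, which becomes the value of [p] at [L]. *)
  pose d : 'cV[rat]_m.+1 := \col_k (p`_k / 'C(m, k)%:R).
  exists (fun n => sym_comb m A B (map_mx ratr d) n.-1); split.
  - move=> n; have /choice[x xE] (k : 'I_m.+1) :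
        exists x : rat, ratr x = sym_prod m A B k n.-1.
      by have [x _ <-] := rational_sym_prod m A B k n.-1 hArat hBrat; exists x.
    exists (\sum_k x k * d k 0) => //.
    rewrite rmorph_sum; apply: eq_bigr => k _.
    by rewrite rmorphM /= xE [in RHS]mxE.
  (* If the solution vanished from index 1 on, the first window would force [d = 0], hence
     [p = 0]. *)
  - apply: contrapT => S0; case/eqP: p0.
    suff d0 : d = 0.
      apply/polyP => k; rewrite coef0.
      have [km|km] := ltnP k m.+1; last by rewrite nth_default ?(leq_trans szp).
      have /matrixP/(_ (Ordinal km) 0) := d0; rewrite !mxE /= => /eqP.
      by rewrite mulf_eq0 invr_eq0 (negPf (C0 _ (Ordinal km))) orbF => /eqP.
    apply: (@map_mx_inj _ _ (@ratr R)); rewrite map_mx0.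
    apply: (@sym_comb_inj R m A B 0 _ _ (hW 1 isT)) => i _.
    rewrite [RHS]big1 => [|k _]; last by rewrite mxE mulr0.
    by apply: contrapT => /eqP Si; apply: S0; exists i.+1.
  - exact: sym_comb_solves.
  - rewrite winE /= -px (horner_coef_wide _ (leq_trans (size_poly _ _) szp)).
    rewrite (eq_bigr (fun k : 'I_m.+1 => 'C(m, k)%:R * L ^+ k * map_mx ratr d k 0)).
      exact: cvg_sym_comb.
    move=> k _; rewrite coef_map !mxE /= rmorphM fmorphV /= ratr_nat.
    by rewrite -mulrA [RHS]mulrC -[RHS]mulrA divfK ?C0 // mulrC.
move=> [S [ratS [n0 [n0_gt0 Sn0]] SR]].
have [e eE] := solves_RmP _ _ _ _ hW SR.
have ratS1 : rational_valued (fun n => S n.+1) by move=> n; apply: ratS.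
have [d dE] := rational_coef_sym_comb _ _ _ _ _ hArat hBrat ratS1 (hW 1 isT) eE.
rewrite winE; under eq_fun do rewrite eE.
move=> /(cvg_unique _ (cvg_sym_comb m A B L e A0 hlim))-/(_ (@norm_hausdorff _ _)) lim0.
(* The value of this polynomial at [L] is the limit in [lim0]; were it the zero polynomial, [d] and
   with it [S n0] would vanish. *)
exists (\poly_(k < m.+1) ('C(m, k)%:R * d (inord k) 0)); split.
- apply: contraNneq Sn0 => p0.
  rewrite -(prednK n0_gt0) eE /sym_comb big1 // => k _; rewrite dE mxE.
  have := congr1 (fun q : {poly rat} => q`_k) p0.
  rewrite coef_poly ltn_ord coef0 inord_val => /eqP.
  by rewrite mulf_eq0 (negPf (C0 _ k)) => /eqP ->; rewrite rmorph0 mulr0.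
- exact: size_poly.
apply/rootP; rewrite -lim0.
rewrite (horner_coef_wide _ (leq_trans (size_poly _ _) (size_poly _ _))).
apply: eq_bigr => k _.
rewrite coef_map coef_poly ltn_ord inord_val dE mxE /= rmorphM /= ratr_nat.
by rewrite mulrAC.
Qed.
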